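(* Let $\mathcal{P}$ be any polyhedron with a labelling of all its edges that is coherent, giving rise to anticlockwise oriented faces of $\mathcal{P}$, except possibly for one face $F$ of $\mathcal{P}$ with $n_F$ edges, where an anticlockwise increasing pattern of inequalities of labels need not exist. Let $\mathcal{Q}$ be the polyhedron obtained by adding a pyramid over an $n_F$-gon whose base is attached to $F$ such that the face $F$ vanishes in $\mathcal{Q}$ but none of the edges of $F$ vanish in $\mathcal{Q}$. Then there exists a coherent labelling of the polyhedron $\mathcal{Q}$ extending the given labelling of the edges of $\mathcal{P}$.
   Context: Polyhedra are three-dimensional, and labellings assign integers to all the edges. Each face of a polyhedron is oriented by the outward normal, so its edges are traversed anticlockwise as seen from outside. A face $G$ with $n_G$ edges has an anticlockwise increasing pattern of labels if there is a choice of starting edge such that the successive labels of the edges of $G$, read anticlockwise from that edge, satisfy $a_1<a_2<\cdots<a_{n_G}$. A labelling of all the edges of a polyhedron with integers is coherent if every face has such a pattern; the labelling of $\mathcal{P}$ in the claim is required to have such a pattern on every face other than $F$.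
   Formalization: The claim fails as stated (e.g. labels 0,1,2 or all equal on F). Proved: the labelling extends if some label of F is followed anticlockwise by one larger by at least 2; if the labels of F are merely not all equal, it extends after multiplying all labels by a positive integer. *)

(* Defs.v *)
From HB Require Import structures.
From mathcomp Require Import all_boot all_order all_algebra.
From mathcomp Require Import finmap.
From mathcomp Require Import all_classical all_reals all_analysis.

Set Implicit Arguments.
Unset Strict Implicit.
Unset Printing Implicit Defensive.
Import Order.TTheory GRing.Theory Num.Theory.
Import numFieldNormedType.Exports.
Local Open Scope classical_set_scope.
Local Open Scope ring_scope.

Section Geometry.
Variable R : realType.
Local Notation pt := 'rV[R]_3.
Implicit Types (a n p q x y : pt) (c d : seq pt) (A : set pt) (e : pt * pt).

Definition dot (u v : pt) : R := \sum_i u 0 i * v 0 i.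

Definition det3 (u v w : pt) : R := \det (\matrix_(i < 3) [:: u; v; w]`_i).

Definition seg e : set pt := [set e.1 + t *: (e.2 - e.1) | t in `[0, 1]].

Definition open_seg e : set pt := [set e.1 + t *: (e.2 - e.1) | t in `]0, 1[].

(* Oriented sides (p, q) of the closed polygonal line with cyclic vertex list
   c, in the order in which they are traversed. *)
Definition sides c : seq (pt * pt) := zip c (rot 1 c).

Definition rev_side e : pt * pt := (e.2, e.1).

Definition outline c : set pt := \bigcup_(e in [set` sides c]) seg e.

Definition same_cycle c d : Prop := exists k, d = rot k c.

Definition simple_polygon c : Prop :=
  [/\ (2 < size c)%N, uniq c
    & forall e e' x, e \in sides c -> e' \in sides c -> e <> e' ->
        seg e x -> seg e' x ->
        x \in [:: e.1; e.2] /\ x \in [:: e'.1; e'.2] ].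

(* A is the closed planar region enclosed by the simple polygon c, and c runs
   anticlockwise around A when seen from the side the unit vector n points to:
   along a side (p, q), the region A is locally the half-plane on the left of
   q - p, i.e. the one n x (q - p) points into. By the Jordan curve theorem
   these conditions determine A from c, and n from c. *)
Definition encloses n c A : Prop :=
  [/\ dot n n = 1,
      compact A /\ outline c `<=` A,
      forall x y, A x -> A y -> dot n (y - x) = 0,
      forall x, A x -> ~ outline c x ->
        \forall y \near x, dot n (y - x) = 0 -> A y
    & forall e x, e \in sides c -> open_seg e x ->
        \forall y \near x, dot n (y - x) = 0 ->
          (A y <-> 0 <= det3 n (e.2 - e.1) (y - x)) ].

(* A solid polyhedron in R^3, not necessarily convex, with its faces. *)
Record polyhedron := Polyhedron {
  body : set pt;
  face : finType;
  (* in cyclic order, anticlockwise as seen from outside *)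
  vertices : face -> seq pt;
  (* outward unit normal *)
  normal : face -> pt;
  region : face -> set pt;
  body_neq0 : body !=set0;
  body_compact : compact body;
  body_connected : connected (interior body);
  face_simple : forall f, simple_polygon (vertices f);
  face_encloses : forall f, encloses (normal f) (vertices f) (region f);
  (* body is closed, so the left-hand side is its topological boundary *)
  body_boundary : body `\` interior body = \bigcup_f region f;
  normal_outward : forall f x, region f x -> ~ outline (vertices f) x ->
    \forall y \near x, body y <-> dot (normal f) (y - x) <= 0;
  side_reversed : forall f e, e \in sides (vertices f) ->
    exists! g, rev_side e \in sides (vertices g);
  (* adjacent faces are not parts of one larger face *)
  side_not_flat : forall f g e, e \in sides (vertices f) ->
    rev_side e \in sides (vertices g) -> normal f <> normal g;
  face_meet : forall f g x, f <> g -> region f x -> region g x ->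
    (x \in vertices f /\ x \in vertices g) \/
    (exists e, [/\ e \in sides (vertices f), rev_side e \in sides (vertices g)
                 & seg e x])
}.

(* The (unoriented) edge of a polyhedron underlying an oriented side. *)
Definition edge e : {fset pt} := [fset e.1; e.2]%fset.

(* A labelling gives an integer to each edge; its values on pairs of points
   that are not edges of the polyhedron at hand are irrelevant. *)
Definition labelling := {fset pt} -> int.

Definition side_labels (L : labelling) c : seq int :=
  [seq L (edge e) | e <- sides c].

Definition increasing_pattern (L : labelling) c : Prop :=
  exists k, sorted <%R (rot k (side_labels L c)).

Definition coherent_except (P : polyhedron) (F : face P) (L : labelling) :=
  forall f : face P, f != F -> increasing_pattern L (vertices f).

Definition coherent (P : polyhedron) (L : labelling) : Prop :=
  forall f : face P, increasing_pattern L (vertices f).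

Definition agree_on (P : polyhedron) (L M : labelling) : Prop :=
  forall (f : face P) e, e \in sides (vertices f) -> M (edge e) = L (edge e).

Definition pyramid a A : set pt :=
  [set a + u.1 *: (u.2 - a) | u in `[0, 1] `*` A].

(* Q is P with the pyramid of apex a over the face F glued along F. The last
   three clauses say that the faces of Q are the faces of P other than F and,
   for each side of F, a lateral triangle of the pyramid; as Q is a polyhedron,
   side_not_flat for Q makes all the edges of F edges of Q. *)
Definition pyramid_attached (P : polyhedron) (F : face P) a
    (Q : polyhedron) : Prop :=
  [/\ forall x, region F x -> 0 < dot (normal F) (a - x),
      body P `&` pyramid a (region F) = region F /\
        body Q = body P `|` pyramid a (region F),
      forall f : face P, f != F ->
        exists g : face Q, same_cycle (vertices f) (vertices g),
      forall e, e \in sides (vertices F) ->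
        exists g : face Q, same_cycle [:: e.1; e.2; a] (vertices g)
    & forall g : face Q,
        (exists2 f : face P, f != F & same_cycle (vertices f) (vertices g)) \/
        (exists2 e, e \in sides (vertices F)
                  & same_cycle [:: e.1; e.2; a] (vertices g)) ].

(* Integer labels x_v on the lateral edges of a pyramid over a polygon with side
   labels s make every lateral triangle coherent if and only if s increases by
   at least 2 between two cyclically consecutive sides: one x_v has to lie
   strictly between the labels of the two sides at v. Side labels (0, 1, 2), for
   instance, admit no such x. Constant side labels admit none, not even rational
   ones; otherwise s jumps up somewhere, and doubling all labels makes room for
   an integer. Both situations occur for polyhedra that are coherent except on
   one face: the first on a tetrahedron, the second on an octahedron. *)
Definition has_gap (L : labelling) c : Prop :=
  let s := side_labels L c in exists2 u, u \in zip s (rot 1 s) & u.1 + 1 < u.2.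

Definition not_all_equal (L : labelling) c : Prop :=
  exists i j, [/\ i \in side_labels L c, j \in side_labels L c & i <> j].

Definition scale (k : int) (L : labelling) : labelling := fun E => k * L E.

End Geometry.

(* Main.v *)
Require Import Defs.
From mathcomp Require Import all_boot all_order all_algebra.
From mathcomp Require Import finmap.
From mathcomp Require Import all_classical all_reals all_analysis.
From mathcomp Require Import zify.
Import Order.TTheory GRing.Theory Num.Theory.
Local Open Scope ring_scope.

(** The only new edges of Q join the apex a to the vertices of F, and the only
    new faces are the lateral triangles; so the task is to label the new edges
    so that these triangles become coherent. Number the vertices v_0, ...,
    v_(n-1) and the side labels s_0, ..., s_(n-1) of F cyclically, with s_i on
    the side from v_i to v_(i+1), and let x_i be the label of the edge from a to
    v_i. The triangle over side i carries the labels (s_i, x_(i+1), x_i), which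
    must increase in some cyclic shift.

    If some side label exceeds the previous one by at least 2, number the
    vertices so that s_(n-1) + 1 < s_0, put x_0 = s_(n-1) + 1, and choose
    x_1 > x_2 > ... > x_(n-1), all larger than every side label. The triangle
    over side 0 is then increasing in the form x_0 < s_0 < x_1, and every other
    one in the form s_i < x_(i+1) < x_i ([lateral_labelling]). The apex is not
    a point of P ([apex_notin_body]), so no label of P has been changed
    ([extend_over_pyramid]).

    If the side labels are merely not all equal, some label is smaller than the
    next one, and doubling all labels reduces to the previous case
    ([not_all_equal_gap]). *)

(** * Rotations of cyclic lists *)

Lemma zip_rot (S T : Type) k (s : seq S) (t : seq T) :
  size s = size t -> zip (rot k s) (rot k t) = rot k (zip s t).
Proof.
move=> st; rewrite -[rot k (zip s t)]zip_unzip [unzip1 _]map_rot.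
by rewrite [unzip2 _]map_rot -/unzip1 -/unzip2 unzip1_zip ?unzip2_zip ?st.
Qed.

Lemma rot_rot_merge (T : Type) i j (s : seq T) :
  exists k, rot i (rot j s) = rot k s.
Proof.
rewrite (rot_minn j) (rot_minn i) size_rot rot_add_mod ?geq_minr //.
by eexists.
Qed.

Lemma rot_unrot (T : Type) i j (s : seq T) :
  exists k, rot i s = rot k (rot j s).
Proof.
have [k ek] := rot_rot_merge T i (size (rot j s) - j) (rot j s).
by exists k; rewrite -ek -/(rotr j _) rotK.
Qed.

Lemma zip_map2 (S T : Type) (f : S -> T) (s t : seq S) :
  zip (map f s) (map f t) = [seq (f u.1, f u.2) | u <- zip s t].
Proof. by elim: s t => [|x s IHs] [|y t] //=; rewrite IHs. Qed.

Lemma head_rot (T : Type) x (s : seq T) i :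
  (i < size s)%N -> head x (rot i s) = nth x s i.
Proof. by move=> lt_is; rewrite /rot (drop_nth x lt_is). Qed.

Lemma path_zip (T : Type) (r : rel T) x p :
  path r x p = all (fun u => r u.1 u.2) (zip (belast x p) p).
Proof. by elim: p x => //= y p IHp x; rewrite IHp. Qed.

Lemma cycle_zip (T : Type) (r : rel T) s :
  cycle r s = all (fun u => r u.1 u.2) (zip s (rot 1 s)).
Proof. by case: s => // x s; rewrite /= path_zip belast_rcons rot1_cons. Qed.

(** * Side labels of a face *)

Section Labels.
Variable R : realType.
Local Notation pt := 'rV[R]_3.
Implicit Types (L M : labelling R) (c d : seq pt) (a : pt).

Lemma sides_rot k c : sides (rot k c) = rot k (sides c).
Proof. by rewrite /sides rot_rot zip_rot ?size_rot. Qed.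

Lemma side_labels_rot L k c : side_labels L (rot k c) = rot k (side_labels L c).
Proof. by rewrite /side_labels sides_rot map_rot. Qed.

Lemma size_side_labels L c : size (side_labels L c) = size c.
Proof. by rewrite size_map size_zip size_rot minnn. Qed.

Lemma mem_side c e : e \in sides c -> e.1 \in c /\ e.2 \in c.
Proof.
move=> ec; split.
- by have := map_f fst ec; rewrite -/unzip1 unzip1_zip ?size_rot.
- by have := map_f snd ec; rewrite -/unzip2 unzip2_zip ?size_rot // mem_rot.
Qed.

Lemma increasing_pattern_rot L c d :
  same_cycle c d -> increasing_pattern L c -> increasing_pattern L d.
Proof.
move=> [k ->] [i inc]; have [j ej] := rot_unrot _ i k (side_labels L c).
by exists j; rewrite side_labels_rot -ej.
Qed.

Lemma eq_increasing_pattern L M c :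
  {in sides c, forall e, M (edge e) = L (edge e)} ->
  increasing_pattern L c -> increasing_pattern M c.
Proof.
move=> eqM [i inc]; exists i; congr (sorted _ (rot i _)): inc.
by apply/eq_in_map => e /eqM.
Qed.

Lemma increasing_pattern_scale L (k : int) c :
  0 < k -> increasing_pattern L c -> increasing_pattern (scale k L) c.
Proof.
move=> k_gt0 [i inc]; exists i; rewrite /side_labels /scale.
rewrite (map_comp ( *%R k)) -map_rot; apply: homo_sorted inc => x y.
by rewrite ltr_pM2l.
Qed.

(** A gap may be brought to the place where the cyclic list closes up. *)
Lemma has_gap_rot L c : has_gap L c ->
  exists k, let s := side_labels L (rot k c) in last 0 s + 1 < head 0 s.
Proof.
move=> [u /(nthP (0, 0)) [i]]; set s := side_labels L c.
rewrite size_zip size_rot minnn => lt_is eu gap; exists i.+1.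
rewrite side_labels_rot -/s rotS //; cbv zeta.
have : head (0, 0) (zip (rot i s) (rot 1 (rot i s))) = u.
  by rewrite rot_rot zip_rot ?size_rot // head_rot // size_zip size_rot minnn.
have : (0 < size (rot i s))%N by rewrite size_rot; case: (s) lt_is.
case: (rot i s) => // h t _; rewrite rot1_cons last_rcons.
by case: t => [|h' t] /= eq_u; move: gap; rewrite -eq_u.
Qed.

(** Were no label smaller than the next one, the labels would be cyclically
    nonincreasing, hence constant. A strict increase doubles to at least 2. *)
Lemma not_all_equal_gap L c : not_all_equal L c -> has_gap (scale 2 L) c.
Proof.
move=> [x [y [xs ys neq_xy]]]; rewrite /has_gap.
have -> : side_labels (scale 2 L) c = [seq 2 * z | z <- side_labels L c].
  by rewrite /side_labels /scale -map_comp.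
move: (side_labels L c) xs ys => s xs ys /=.
have [/hasP [u us lt_u]|] := boolP (has (fun u => u.1 < u.2) (zip s (rot 1 s))).
  exists (2 * u.1, 2 * u.2); last by move: lt_u => /=; lia.
  by rewrite -map_rot zip_map2; apply: map_f us.
rewrite -all_predC => noninc; case: neq_xy.
have /allrelP ge_s : all2rel (fun z t : int => t <= z) s.
  rewrite -cycle_all2rel => [|t z w]; last by move=> ? /le_trans; apply.
  rewrite cycle_zip; by apply: sub_all noninc => u /=; rewrite -leNgt.
by apply/eqP; rewrite eq_le !ge_s.
Qed.

(** The three cyclic shifts of the increasing pattern on a triangle. *)
Lemma increasing_triangle M (p q a : pt) (s x y : int) :
  M (edge (p, q)) = s -> M (edge (q, a)) = y -> M (edge (a, p)) = x ->
  [|| s < y < x, y < x < s | x < s < y] -> increasing_pattern M [:: p; q; a].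
Proof.
move=> es ey ex; rewrite /increasing_pattern /side_labels /sides /= es ey ex.
case/or3P=> /andP [lt1 lt2].
- by exists 0; rewrite /= lt1 lt2.
- by exists 1; rewrite /= lt1 lt2.
- by exists 2; rewrite /= lt1 lt2.
Qed.

(** The labels of the edges at the apex of a pyramid over a polygon with a
    gap. Only edges containing the apex are relabelled. *)
Lemma lateral_labelling L c a :
  uniq c -> (1 < size c)%N -> a \notin c -> has_gap L c ->
  exists2 M : labelling R, (forall E, a \notin E -> M E = L E)
    & forall e, e \in sides c -> increasing_pattern M [:: e.1; e.2; a].
Proof.
move=> Uc c_gt1 ac /has_gap_rot [k].
move: Uc c_gt1 ac; rewrite -(rot_uniq k) -(size_rot k c) -(mem_rot k).
suff main d : uniq d -> (1 < size d)%N -> a \notin d ->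
    last 0 (side_labels L d) + 1 < head 0 (side_labels L d) ->
    exists2 M : labelling R, (forall E, a \notin E -> M E = L E)
      & forall e, e \in sides d -> increasing_pattern M [:: e.1; e.2; a].
  move=> Uc c_gt1 ac gap; have [M ML inc] := main _ Uc c_gt1 ac gap.
  by exists M => // e ec; apply: inc; rewrite sides_rot mem_rot.
move=> Ud d_gt1 ad gap; pose s := side_labels L d; pose n := size d.
have sz_s : size s = n by rewrite size_side_labels.
(* B bounds all side labels, so x 1 > x 2 > ... > x (n - 1) > B. *)
pose B : int := \sum_(z <- s) `|z|.
have leB z : z \in s -> z <= B.
  move=> zs; rewrite /B (big_rem z zs) /=; apply: le_trans (ler_norm z) _.
  by rewrite lerDl sumr_ge0.
pose x j : int := if j == 0%N then last 0 s + 1 else B + (n - j)%:Z.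
(* The first vertex of d in E is the other end of the edge E from the apex. *)
pose M : labelling R := fun E => if a \in E then x (find (mem E) d) else L E.
exists M => [E aE|]; first by rewrite /M (negPf aE).
have Mlat p : p \in d -> M [fset a; p]%fset = x (index p d).
  move=> pd; rewrite /M !inE eqxx /=; congr x; apply: eq_in_find => q qd /=.
  by rewrite !inE; case: eqVneq => // eqa; rewrite -eqa qd in ad.
move=> e /(nthP (0, 0)) [i]; rewrite size_zip size_rot minnn => lt_in.
rewrite /sides nth_zip ?size_rot // => <- /=.
set p := nth 0 d i; set q := nth 0 (rot 1 d) i.
have pd : p \in d by rewrite mem_nth.
have qd : q \in d by rewrite -(mem_rot 1) mem_nth ?size_rot.
have ip : index p d = i by rewrite index_uniq.
have iq : index q d = if i.+1 == n then 0%N else i.+1.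
  rewrite /q /n; case: (d) Ud lt_in => // v t Ud lt_in.
  rewrite rot1_cons nth_rcons -[size (v :: t)]/(size t).+1 eqSS.
  case: (ltngtP i (size t)) => [lt_it|gt_it|_].
  - by rewrite -[nth 0 t i]/(nth 0 (v :: t) i.+1) index_uniq.
  - by move: lt_in => /=; lia.
  - by rewrite /= eqxx.
have si : s`_i = L (edge (p, q)).
  rewrite /s /side_labels (nth_map (0, 0)) ?nth_zip ?size_rot //.
  by rewrite size_zip size_rot minnn.
have es : M (edge (p, q)) = s`_i.
  rewrite si /M ifN //= !inE negb_or.
  by apply/andP; split; apply: contraNneq ad => ->.
have ex : M (edge (a, p)) = x i by rewrite Mlat // ip.
have ey : M (edge (q, a)) = x (index q d) by rewrite /edge fsetUC Mlat.
have si_s : s`_i \in s by rewrite mem_nth ?sz_s.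
have s0B : head 0 s <= B by rewrite leB // -nth0 mem_nth // sz_s; lia.
have lt_i : (i < n)%N by [].
have lt_1n : (1 < n)%N by [].
apply: (increasing_triangle _ _ _ _ _ _ _ es ey ex).
move: (leB _ si_s) s0B gap; rewrite iq /x -/s.
case: (eqVneq i 0%N) => [-> |i0].
  have -> : (1%N == n) = false by lia.
  by rewrite nth0 /=; lia.
case: (eqVneq i.+1 n) => [ein|ni]; last by rewrite /=; lia.
by rewrite -nth_last sz_s -ein subSnn /=; move: (head _ _); lia.
Qed.

(** * The glued pyramid *)

Lemma vertices_region (P : polyhedron R) (f : face P) v :
  v \in vertices f -> region f v.
Proof.
move=> vf; have [_ [_ outl] _ _ _] := face_encloses f; apply: outl.
have : v \in unzip1 (sides (vertices f)) by rewrite unzip1_zip ?size_rot.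
case/mapP=> e ef ->; exists e => //.
by exists 0; rewrite ?scale0r ?addr0 // /= in_itv /= lexx ler01.
Qed.

Lemma vertices_body (P : polyhedron R) (f : face P) v :
  v \in vertices f -> body P v.
Proof.
move=> /vertices_region fv.
have : (\bigcup_g region (p := P) g)%classic v by exists f.
by rewrite -body_boundary => -[].
Qed.

(** The apex lies in the pyramid; if it also lay in the body, it would lie in
    the base face, above whose plane it lies strictly. *)
Lemma apex_notin_body (P : polyhedron R) (F : face P) a (Q : polyhedron R) :
  pyramid_attached F a Q -> ~ body P a.
Proof.
move=> [above [glue _] _ _ _] Pa.
have [v /vertices_region Fv] : exists v, v \in vertices F.
  have [szF _ _] := face_simple F.
  by case: (vertices F) szF => // v t _; exists v; rewrite mem_head.
have Fa : region F a.
  rewrite -glue; split=> //; exists (0, v); last by rewrite scale0r addr0.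
  by split; rewrite //= in_itv /= lexx ler01.
have := above a Fa; rewrite subrr /dot big1 ?ltxx // => i _.
by rewrite mxE mulr0.
Qed.

Lemma agree_on_notin (P : polyhedron R) L M a :
  ~ body P a -> (forall E, a \notin E -> M E = L E) -> agree_on P L M.
Proof.
move=> Pa eqM f e /mem_side [e1 e2]; apply: eqM; rewrite !inE negb_or.
by apply/andP; split; apply/eqP => ea; apply: Pa; rewrite ea;
  apply: (@vertices_body P f).
Qed.

Lemma extend_over_pyramid (P : polyhedron R) (F : face P) L a
    (Q : polyhedron R) :
  coherent_except F L -> pyramid_attached F a Q -> has_gap L (vertices F) ->
  exists2 M : labelling R, coherent Q M & agree_on P L M.
Proof.
move=> cohL att gap; have Pa := apex_notin_body _ _ _ _ att.
have [szF UF _] := face_simple F.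
have aF : a \notin vertices F by apply/negP => /vertices_body.
have [M eqM lat] := lateral_labelling L _ a UF (ltnW szF) aF gap.
have agr := agree_on_notin _ _ _ _ Pa eqM.
exists M => // g; have [_ _ _ _ facesQ] := att.
case: (facesQ g) => [[f fF fg]|[e eF eg]]; last first.
  by apply: increasing_pattern_rot eg _; apply: lat.
apply: increasing_pattern_rot fg _.
by apply: eq_increasing_pattern (cohL f fF) => e; apply: agr.
Qed.

End Labels.

Theorem theorem6p4 (R : realType) (P : polyhedron R) (F : face P)
    (L : labelling R) (a : 'rV[R]_3) (Q : polyhedron R) :
  coherent_except F L ->
  pyramid_attached F a Q ->
  (has_gap L (vertices F) ->
     exists2 M : labelling R, coherent Q M & agree_on P L M) /\
  (not_all_equal L (vertices F) ->
     exists2 k : int, 0 < k &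
       exists2 M : labelling R, coherent Q M & agree_on P (scale k L) M).
Proof.
move=> cohL att; split=> [|neq]; first exact: extend_over_pyramid att.
exists 2 => //; apply: extend_over_pyramid att _; last exact: not_all_equal_gap.
by move=> f fF; apply: increasing_pattern_scale => //; apply: cohL.
Qed.
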